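(* Let $X$ be a separable space and $Y$ a pseudo-metric space. Then: (a) If $X\times Y$ is a Baire space, then it is $\beta$-défavorable of $\mathcal{J}_p$ and an $\mathcal{N}$-space. (b) If $X\times Y$ is a non-meager space, then it is a g$\mathcal{N}$-space.
   Context: No separation axioms are assumed; ''compact'' means every open cover has a finite subcover. $\mathscr{O}(S)$ is the family of non-void open subsets of a space $S$. A subset of $S$ is meager if it is a countable union of sets whose closures have empty interior, non-meager otherwise; $S$ is non-meager if it is non-meager in itself, and Baire if every $U\in\mathscr{O}(S)$ is non-meager in $S$. A $\mathcal{J}_p(S)$-play is a sequence $\{(B_i;A_i,a_i)\}_{i=1}^\infty$ in $\mathscr{O}(S)\times\mathscr{O}(S)\times S$ with $B_i\supseteq A_i\supseteq B_{i+1}$ for all $i$; Player $\beta$ moves first and picks the $B_i$, Player $\alpha$ picks the $(A_i,a_i)$, alternately (the points $a_i\in S$ are otherwise arbitrary). Player $\alpha$ wins the play if $\overline{\{a_i : i\in\mathbb{N}\}}\cap\bigcap_{i=1}^\infty A_i\neq\emptyset$; otherwise Player $\beta$ wins. A strategy for Player $\beta$ determines each of his moves from the previous moves of Player $\alpha$, and it is winning if he wins every play consistent with it. $S$ is $\beta$-défavorable of $\mathcal{J}_p$ if Player $\beta$ has no winning strategy in the $\mathcal{J}_p(S)$-game. $S$ is an $\mathcal{N}$-space if for every compact space $K$ and every separately continuous $f\colon S\times K\to\mathbb{R}$ there is a dense set $R\subseteq S$ such that $f$ is jointly continuous at each point of $R\times K$. $S$ is a g$\mathcal{N}$-space if for every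 compact space $K$ and every separately continuous $f\colon S\times K\to\mathbb{R}$ there is at least one point $s\in S$ such that $f$ is jointly continuous at each point of $\{s\}\times K$. *)

(* Defs.v *)
From mathcomp Require Import all_boot all_order all_algebra.
From mathcomp Require Import all_classical all_reals all_analysis.
Import numFieldNormedType.Exports.

Set Implicit Arguments.
Unset Strict Implicit.
Unset Printing Implicit Defensive.

Local Open Scope classical_set_scope.

Section Category.
Variable S : topologicalType.

Definition nonvoid_open (U : set S) : Prop := open U /\ U !=set0.

Definition separable_space : Prop :=
  exists D : set S, countable D /\ dense D.

Definition meager (A : set S) : Prop :=
  exists F : nat -> set S,
    (forall n, (closure (F n))° = set0) /\ A = \bigcup_n F n.

Definition nonmeager_space : Prop := ~ meager [set: S].

Definition Baire_space : Prop :=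
  forall U : set S, nonvoid_open U -> ~ meager U.

End Category.

(* The game is indexed from 0 rather than from 1. *)
Section Game.
Variable S : topologicalType.

Definition Jp_play (B A : nat -> set S) (a : nat -> S) : Prop :=
  forall i, [/\ nonvoid_open (B i), nonvoid_open (A i),
                A i `<=` B i & B i.+1 `<=` A i].

Definition alpha_wins (A : nat -> set S) (a : nat -> S) : Prop :=
  closure (range a) `&` \bigcap_i A i !=set0.

(* The argument is the list of Player alpha's previous moves (A_i, a_i),
   oldest first. *)
Definition beta_strategy : Type := seq (set S * S) -> set S.

(* The finite lists of legal moves of Player alpha against a Player beta who
   follows sigma. *)
Inductive alpha_moves (sigma : beta_strategy) : seq (set S * S) -> Prop :=
| alpha_moves_nil : alpha_moves sigma [::]
| alpha_moves_rcons (s : seq (set S * S)) (A : set S) (a : S) :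
    alpha_moves sigma s -> nonvoid_open A -> A `<=` sigma s ->
    alpha_moves sigma (rcons s (A, a)).

(* sigma always answers with a legal move.  The first clause requires an
   opening move, so there is no legal strategy on the empty space. *)
Definition legal_strategy (sigma : beta_strategy) : Prop :=
  nonvoid_open (sigma [::]) /\
  forall (s : seq (set S * S)) (A : set S) (a : S),
    alpha_moves sigma (rcons s (A, a)) ->
    nonvoid_open (sigma (rcons s (A, a))) /\ sigma (rcons s (A, a)) `<=` A.

Definition consistent_play (sigma : beta_strategy)
    (B A : nat -> set S) (a : nat -> S) : Prop :=
  Jp_play B A a /\ forall i, B i = sigma (mkseq (fun j => (A j, a j)) i).

Definition beta_winning (sigma : beta_strategy) : Prop :=
  legal_strategy sigma /\
  forall (B A : nat -> set S) (a : nat -> S),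
    consistent_play sigma B A a -> ~ alpha_wins A a.

Definition beta_defavorable_Jp : Prop :=
  ~ exists sigma : beta_strategy, beta_winning sigma.

End Game.

Section Namioka.
Variable R : realType.

Definition separately_continuous (S K : topologicalType) (f : S * K -> R) :
    Prop :=
  (forall s : S, continuous (fun k : K => f (s, k))) /\
  (forall k : K, continuous (fun s : S => f (s, k))).

Definition N_space (S : topologicalType) : Prop :=
  forall K : topologicalType, cover_compact [set: K] ->
  forall f : S * K -> R, separately_continuous f ->
  exists D : set S, dense D /\
    forall (s : S) (k : K), D s -> {for (s, k), continuous f}.

Definition gN_space (S : topologicalType) : Prop :=
  forall K : topologicalType, cover_compact [set: K] ->
  forall f : S * K -> R, separately_continuous f ->
  exists s : S, forall k : K, {for (s, k), continuous f}.

End Namioka.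

(* Main.v *)
From HB Require Import structures.
Require Import Defs.
From mathcomp Require Import all_boot all_order all_algebra.
From mathcomp Require Import all_classical all_reals all_analysis.
From mathcomp Require Import zify lra.
Import Order.TTheory GRing.Theory Num.Theory.
Import numFieldNormedType.Exports.

(** Everything reduces to one property of a space [S]: the opening move of a
winning strategy of Player beta in the game J_p is always meager.

The property holds for [X * Y] ([winning_opening_meager_prod]).  As in Oxtoby's
theorem on the Choquet game, Zorn's lemma organises the plays following a given
strategy into a tree whose n-th level gives pairwise disjoint moves of beta
with union dense in the opening move; a point common to all these dense open
unions determines an infinite play whose intersection contains it.  If the
opening move is not meager such a point exists, and the tree can be restricted
to moves of alpha of any kind available inside every nonvoid open set
([good_play_of_nonmeager_opening]).  Alpha uses this freedom to take sets [A_n]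
whose projection to [Y] lies in a small ball, and points [a_n] whose second
coordinate is the centre of that ball, while their first coordinate runs
through a countable dense subset of [X], visiting each element infinitely
often.  Any point of the intersection of the [A_n] is then in the closure of
the [a_n], so alpha wins.

The property makes every separately continuous [f] on [S * K], with [K]
compact, jointly continuous at every point of [{s} * K] for all [s] outside a
meager set ([meager_discontinuity]).  Otherwise, for some [e > 0], there would
be a nonmeager open set [W] none of whose nonvoid open subsets [U] satisfies
[`|f (s, k) - f (t, k)| <= 3 * e] for all [s], [t] in [U] and all [k].  From
such a [W] beta wins ([winning_of_large_osc]): at step [n] he finds a pair
[(k, k')] whose two members are nearly indistinguishable by the points [a_i]
already played, though every point of his next move tells them apart by at
least [e].  At a cluster point of these pairs no [a_i] distinguishes the two
members, and neither does any point in the closure of the [a_i]; yet every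
point common to all the moves does.

In a Baire space nonvoid open sets are not meager, so beta has no winning
strategy and the good points [s] are dense; in a nonmeager space the good
points are not all missing. *)

Set Implicit Arguments.
Unset Strict Implicit.
Unset Printing Implicit Defensive.

Local Open Scope classical_set_scope.
Local Open Scope ring_scope.

(** * Meager sets *)

Lemma nowhere_denseS (S : topologicalType) (A B : set S) :
  A `<=` B -> (closure B)° = set0 -> (closure A)° = set0.
Proof.
move=> AB B0; rewrite -subset0 -B0.
by apply: interiorS; exact: closureS.
Qed.

Lemma meagerS (S : topologicalType) (A B : set S) :
  A `<=` B -> meager B -> meager A.
Proof.
move=> AB [F [F0 BF]]; exists (fun n => F n `&` A); split => [n|].
  by apply: nowhere_denseS (F0 n) => x [].
by rewrite -setI_bigcupl -BF; apply/esym/setIidr.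
Qed.

Lemma meager_nowhere_dense (S : topologicalType) (A : set S) :
  (closure A)° = set0 -> meager A.
Proof.
by move=> A0; exists (fun=> A); split=> //; rewrite bigcup_const//; exists 0%N.
Qed.

Lemma meager_bigcup (S : topologicalType) (A : nat -> set S) :
  (forall n, meager (A n)) -> meager (\bigcup_n A n).
Proof.
move=> /choice[F AF].
exists (fun n => if @unpickle (nat * nat)%type n is Some ij
                 then F ij.1 ij.2 else set0); split => [n|].
  case: unpickle => [[i j]|]; first by have [] := AF i.
  by rewrite closure0 interior0.
rewrite eqEsubset; split => [x [i _]|x [n _]].
  have [_ ->] := AF i; move=> [j _ Fx].
  by exists (pickle (i, j)) => //; rewrite pickleK.
case: unpickle => [[i j]|//] /= Fx.
by exists i => //; have [_ ->] := AF i; exists j.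
Qed.

Lemma meagerU (S : topologicalType) (A B : set S) :
  meager A -> meager B -> meager (A `|` B).
Proof.
move=> mA mB; apply: (@meagerS _ _ (\bigcup_n (if n is 0%N then A else B))).
  by move=> x [Ax|Bx]; [exists 0%N|exists 1%N].
by apply: meager_bigcup => -[].
Qed.

(** If the closure of [W `\` O] contained a nonvoid open set [U], then [U] would
meet [W], hence [O], and [U `&` W `&` O] would be a nonvoid open set inside the
closure of a set disjoint from it. *)
Lemma nowhere_dense_setD (S : topologicalType) (W O : set S) :
  open O -> (forall U, nonvoid_open U -> U `<=` W -> U `&` O !=set0) ->
  open W -> (closure (W `\` O))° = set0.
Proof.
move=> oO dO oW; rewrite -subset0 => x Ux.
set U := (closure (W `\` O))°; have oU : open U by exact: open_interior.
have UWO : U `<=` closure (W `\` O) by exact: interior_subset.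
have [y [[Wy _] Uy]] := UWO _ Ux U (open_nbhs_nbhs (conj oU Ux)).
have oUW : open (U `&` W) by exact: openI.
have [z [[Uz Wz] Oz]] : (U `&` W) `&` O !=set0.
  by apply: dO; [split=> //; exists y|move=> ? []].
have [t [[_ nOt] [_ Ot]]] : (W `\` O) `&` (U `&` O) !=set0.
  exact: UWO Uz _ (open_nbhs_nbhs (conj (openI oU oO) (conj Uz Oz))).
exact: nOt.
Qed.

(** * Strategies and the tree of plays *)

Lemma alpha_moves_rconsE (S : topologicalType) (sigma : beta_strategy S)
    (s : seq (set S * S)) (m : set S * S) :
  alpha_moves sigma (rcons s m) ->
  [/\ alpha_moves sigma s, nonvoid_open m.1 & m.1 `<=` sigma s].
Proof.
move=> H; inversion H as [E|s' A a Hs HA HAs E].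
  by have := congr1 size E; rewrite size_rcons.
by have [<- <-] := rcons_inj E.
Qed.

Lemma legal_nonvoid (S : topologicalType) (sigma : beta_strategy S)
    (s : seq (set S * S)) :
  legal_strategy sigma -> alpha_moves sigma s -> nonvoid_open (sigma s).
Proof.
by case=> o0 legalS; case/lastP: s => [//|s [A a]] /legalS[].
Qed.

Lemma consistent_of_alpha_moves (S : topologicalType) (sigma : beta_strategy S)
    (m : nat -> set S * S) :
  legal_strategy sigma -> (forall n, alpha_moves sigma (mkseq m n)) ->
  consistent_play sigma (fun n => sigma (mkseq m n))
    (fun n => (m n).1) (fun n => (m n).2).
Proof.
move=> legal am; split=> [n|n]; last first.
  by congr sigma; apply: eq_mkseq => j; case: (m j).
have := am n.+1; rewrite mkseqS => amS.
have [_ ? ?] := alpha_moves_rconsE amS.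
split=> //; first exact: legal_nonvoid.
by move: amS; case: (m n) => A a /(proj2 legal)[].
Qed.

Section PlayTree.
Variables (S : topologicalType) (sigma : beta_strategy S).
Variable good : nat -> set S * S -> Prop.

Definition good_moves (s : seq (set S * S)) : set (set S * S) :=
  [set m | [/\ nonvoid_open m.1, m.1 `<=` sigma s & good (size s) m]].

(** By maximality the answers of beta to these moves have union dense in
[sigma s]. *)
Definition children (s : seq (set S * S)) : set (set S * S) :=
  projT1 (ex_maximal_disjoint_subcollection
    (fun m => sigma (rcons s m)) (good_moves s)).

Fixpoint level (n : nat) : set (seq (set S * S)) :=
  if n is n'.+1 then
    [set t | exists s m, [/\ level n' s, children s m & t = rcons s m]]
  else [set [::]].

Definition covered (n : nat) : set S := \bigcup_(s in level n) sigma s.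

Lemma childrenP s : maximal_disjoint_subcollection
  (fun m => sigma (rcons s m)) (children s) (good_moves s).
Proof. exact: (projT2 (ex_maximal_disjoint_subcollection _ _)). Qed.

Lemma children_good s m : children s m -> good_moves s m.
Proof. by have [+ _ _] := childrenP s; apply. Qed.

Lemma alpha_moves_child s m :
  alpha_moves sigma s -> children s m -> alpha_moves sigma (rcons s m).
Proof. by case: m => A a ams /children_good[? ? _]; exact: alpha_moves_rcons. Qed.

Lemma alpha_moves_level n s : level n s -> alpha_moves sigma s.
Proof.
elim: n s => [s ->|n IH t /= [s [m [ls cm ->]]]]; first exact: alpha_moves_nil.
by apply: alpha_moves_child => //; exact: IH.
Qed.

Hypothesis legal : legal_strategy sigma.

Lemma sub_child s m : alpha_moves sigma s -> children s m ->
  sigma (rcons s m) `<=` m.1.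
Proof.
case: m => A a ams cm.
by have [] := (proj2 legal) s A a (alpha_moves_child ams cm).
Qed.

(** The moves of beta decrease along the tree, so two intersecting moves have
intersecting parents; by induction the parents are equal, and siblings are
disjoint by construction. *)
Lemma level_disjoint n s t : level n s -> level n t ->
  sigma s `&` sigma t !=set0 -> s = t.
Proof.
elim: n s t => [s t -> -> //|n IH ? ?].
move=> [s [m [ls cm ->]]] [t [m' [lt cm' ->]]] [p [ps pt]].
have ams := alpha_moves_level ls; have amt := alpha_moves_level lt.
have [_ ms _] := children_good cm; have [_ mt _] := children_good cm'.
have st : s = t.
  apply: IH => //; exists p; split.
    exact: ms (sub_child ams cm ps).
  exact: mt (sub_child amt cm' pt).
subst t; congr rcons; have [_ tr _] := childrenP s.
by apply: tr => //; exists p.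
Qed.

Hypothesis good_ex : forall n (U : set S), nonvoid_open U ->
  exists m, [/\ nonvoid_open m.1, m.1 `<=` U & good n m].

(** Otherwise a good move of alpha inside the part of [U] left uncovered could be
added to the maximal family [children s]. *)
Lemma children_dense s (U : set S) : alpha_moves sigma s ->
  nonvoid_open U -> U `<=` sigma s ->
  exists2 m, children s m & U `&` sigma (rcons s m) !=set0.
Proof.
move=> ams oU Us; apply: contrapT => no.
have [[A a] /= [oA AU gA]] := good_ex (size s) oU.
have amA : alpha_moves sigma (rcons s (A, a)).
  by apply: alpha_moves_rcons => //; exact: subset_trans Us.
have [[oBA [b Bb]] BA] := (proj2 legal) _ _ _ amA.
have [sub tr max] := childrenP s.
have disj m : children s m ->
    ~ (sigma (rcons s m) `&` sigma (rcons s (A, a)) !=set0).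
  move=> cm [p [pm pA]]; apply: no; exists m => //.
  by exists p; split=> //; exact/AU/BA.
apply: (max (children s `|` [set (A, a)])).
- split; first by move=> ?; left.
  move=> /(_ (A, a) (or_intror erefl)) cA.
  by apply: disj cA _; exists b.
- move=> m [/sub//|->]; split=> //; exact: subset_trans Us.
- move=> i j [ci|->] [cj|->] //.
  + exact: tr.
  + by move=> ij; case: (disj i ci).
  + by rewrite setIC => ij; case: (disj j cj).
Qed.

Lemma open_covered n : open (covered n).
Proof.
apply: bigcup_open => s ls.
by have [] := legal_nonvoid legal (alpha_moves_level ls).
Qed.

Lemma covered_dense n (U : set S) : nonvoid_open U -> U `<=` sigma [::] ->
  U `&` covered n !=set0.
Proof.
move=> [oU [x Ux]] U0; elim: n => [|n [y [Uy [s ls sy]]]].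
  by exists x; split=> //; exists [::] => //; exact: U0.
have ams := alpha_moves_level ls; have [os _] := legal_nonvoid legal ams.
have [||m cm [p [[Up _] pm]]] := @children_dense s (U `&` sigma s) ams.
- by split; [exact: openI|exists y].
- by move=> ? [].
- by exists p; split=> //; exists (rcons s m) => //; exists s, m.
Qed.

(** Disjointness makes the node of each level above [p] unique, so the nodes of
successive levels extend each other and form a single infinite play. *)
Lemma branch_through p : (forall n, covered n p) ->
  exists m : nat -> set S * S,
    forall n, level n (mkseq m n) /\ sigma (mkseq m n) p.
Proof.
move=> cp; have /choice[s sP] : forall n, exists s, level n s /\ sigma s p.
  by move=> n; have [s ls sp] := cp n; exists s.
have /choice[m mP] : forall n, exists m, s n.+1 = rcons (s n) m.
  move=> n; have [[t [m [lt cm E]]] sp] := sP n.+1; exists m.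
  rewrite E; congr rcons; have [ls snp] := sP n.
  apply: (level_disjoint lt ls); exists p; split=> //.
  have [_ + _] := children_good cm; apply.
  apply: (sub_child (alpha_moves_level lt) cm); by rewrite -E.
exists m; suff sE n : s n = mkseq m n by move=> n; rewrite -sE.
elim: n => [|n IH]; last by rewrite mkseqS -IH.
by have [] := sP 0%N.
Qed.

(** The points of the opening move missed by some level form a meager set, so a
nonmeager opening move has a point covered at every level. *)
Lemma good_play_of_nonmeager_opening : ~ meager (sigma [::]) ->
  exists m : nat -> set S * S,
    [/\ forall n, alpha_moves sigma (mkseq m n), forall n, good n (m n)
      & exists p, forall n, (m n).1 p].
Proof.
move=> nm.
have [p [p0 cp]] : exists p, sigma [::] p /\ forall n, covered n p.
  apply: contrapT => no; apply: nm.
  apply: (@meagerS _ _ (\bigcup_n (sigma [::] `\` covered n))).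
    move=> p p0; apply: contrapT => ncp; apply: no; exists p; split=> // n.
    by apply: contrapT => np; apply: ncp; exists n.
  apply: meager_bigcup => n; apply: meager_nowhere_dense.
  apply: nowhere_dense_setD; [exact: open_covered|exact: covered_dense|].
  by have [[]] := legal.
have [m mP] := branch_through cp.
have am n : alpha_moves sigma (mkseq m n) by have [/alpha_moves_level] := mP n.
exists m; split=> //.
  move=> n; have [] := mP n.+1; rewrite mkseqS => -[s [x [_ cm E]]] _.
  have [sE xE] := rcons_inj E; subst s x.
  by have [_ _] := children_good cm; rewrite size_mkseq.
exists p => n; have [+ sp] := mP n.+1; rewrite mkseqS => -[s [x [ls cm E]]].
have [sE xE] := rcons_inj E; subst s x.
by apply: (sub_child (am n) cm); rewrite -mkseqS.
Qed.

End PlayTree.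

(** * The game on the product of a separable and a pseudo-metric space *)

Lemma countable_enum (T : Type) (D : set T) : countable D -> T ->
  exists e : nat -> T, D `<=` range e.
Proof.
move=> /countable_injP[g ginj] t0.
have /choice[e eP] : forall n, exists t, forall d, D d -> g d = n -> t = d.
  move=> n; have [[d [Dd <-]]|no] := pselect (exists d, D d /\ g d = n).
    by exists d => d' Dd' /esym; apply: ginj; exact: mem_set.
  by exists t0 => d Dd gd; case: no; exists d.
by exists e => d Dd; exists (g d) => //; exact: eP.
Qed.

(** Thus [logn 2] runs through the natural numbers, taking each value infinitely
often. *)
Lemma logn2_recurrent (k N : nat) : exists2 n, (N <= n)%N & logn 2 n = k.
Proof.
exists (2 ^ k * N.*2.+1)%N.
  by have := expn_gt0 2 k; nia.
rewrite lognM ?expn_gt0// pfactorK// logn_coprime ?addn0//.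
by rewrite prime_coprime// dvdn2 /= odd_double.
Qed.

(** Of a play in which alpha keeps to the moves [good], every point [p] of the
intersection lies in the closure of the points played: near [p.1] there is a
dense point [e k], and [e k] is the first coordinate of [a_n] for arbitrarily
large [n], when the second coordinate is as close to [p.2] as desired. *)
Lemma winning_opening_meager_prod (R : realType) (X : topologicalType)
    (Y : pseudoMetricType R) : separable_space X ->
  forall sigma : beta_strategy (X * Y)%type,
  beta_winning sigma -> meager (sigma [::]).
Proof.
move=> [D [cD dD]] sigma [legal win]; apply: contrapT => nm.
have [_ [z0 _]] := proj1 legal.
have [e De] := countable_enum cD z0.1.
pose good n (m : set (X * Y) * (X * Y)) := m.2.1 = e (logn 2 n) /\
  forall z, m.1 z -> ball m.2.2 (n.+1%:R^-1 : R) z.2.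
have good_ex n (U : set (X * Y)) : nonvoid_open U ->
    exists m, [/\ nonvoid_open m.1, m.1 `<=` U & good n m].
  move=> [oU [z Uz]].
  pose V := [set w : X * Y | (ball z.2 (n.+1%:R^-1 : R))° w.2].
  have oV : open V.
    apply: (@open_comp _ _ snd); last exact: open_interior.
    by move=> w _; exact: cvg_snd.
  exists (U `&` V, (e (logn 2 n), z.2)); split=> /=.
  - split; first exact: openI.
    exists z; split=> //; rewrite /V /=.
    by apply: nbhs_singleton; apply: nbhs_interior; apply: nbhsx_ballx.
  - by move=> ? [].
  - by split=> //= w [_] /interior_subset.
have [m [am gm [p mp]]] := good_play_of_nonmeager_opening legal good_ex nm.
apply: (win _ _ _ (consistent_of_alpha_moves legal am)).
exists p; split; last by move=> n _; exact: mp.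
move=> B [[U V] /= [Ux Vy] UVB].
have [x [Dx Ux']] : exists x, D x /\ U x.
  have [x [Ux' ?]] : U° `&` D !=set0.
    by apply: dD; [exists p.1; apply: nbhs_singleton; exact: nbhs_interior
                  |exact: open_interior].
  by exists x; split=> //; exact: interior_subset.
have [k _ ek] := De x Dx.
have [r r0 rV] := (nbhs_ballP _ _).1 Vy.
have [N _ NP] := near_infty_natSinv_lt (PosNum r0).
have [n Nn nk] := logn2_recurrent k N.
exists (m n).2; split; first by exists n.
apply: UVB; have [g1 g2] := gm n.
split; first by rewrite g1 nk ek.
apply: rV; apply: ball_sym; apply: le_ball (g2 _ (mp n)).
exact/ltW/(NP n).
Qed.

(** * Compactness and sequences *)

(** [compact_cover] is stated for pointed spaces; the proper filter for which a
cluster point is sought supplies a point. *)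
Lemma cover_compactT_compactT (K : topologicalType) :
  cover_compact [set: K] -> compact [set: K].
Proof.
move=> cK F FF FT; have [k _] := @filter_ex _ _ FF _ FT.
pose pK := HB.pack_for ptopologicalType (Topological.sort K) (isPointed.Build K k).
have : @cover_compact pK setT by exact: cK.
by rewrite -compact_cover; apply.
Qed.

(** Any cluster point of the sequence will do. *)
Lemma compact_sequence_closed (T : topologicalType) (c : nat -> T) :
  compact [set: T] ->
  exists q, forall C : set T, closed C -> (\forall n \near \oo, C (c n)) -> C q.
Proof.
move=> /(_ (c @ \oo) _ (@filterT _ _ _))[q [_]]; rewrite clusterE => cq.
exists q => C cC Cc; rewrite (closure_id C).1//; exact: cq.
Qed.

(** * Separately continuous functions *)

Section JointContinuity.
Variables (R : realType) (S K : topologicalType) (f : S * K -> R).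
Hypothesis cptK : cover_compact [set: K].
Hypothesis sepf : separately_continuous f.

(** How well [s] tells apart the two members of the pair [c]. *)
Definition gap (s : S) (c : K * K) : R := `|f (s, c.1) - f (s, c.2)|.

Lemma gap_continuousl (c : K * K) : continuous (gap^~ c).
Proof.
move=> s; apply: cvg_norm; apply: cvgB; exact: (sepf.2 _ s).
Qed.

Lemma gap_continuousr (s : S) : continuous (gap s).
Proof.
move=> c; apply: cvg_norm; apply: cvgB.
- apply: (@continuous_comp _ _ _ fst (fun k => f (s, k))).
    exact: cvg_fst.
  exact: (sepf.1 s).
apply: (@continuous_comp _ _ _ snd (fun k => f (s, k))); first exact: cvg_snd.
exact: (sepf.1 s).
Qed.

Lemma closed_gap_ge (s : S) (e : R) : closed [set c | e <= gap s c].
Proof.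
apply: (@preimage_closed _ _ (gap s) [set x | e <= x]).
  by move=> c _; exact: gap_continuousr.
exact: closed_ge.
Qed.

Lemma closed_gap_ler (s : S) (e : R) : closed [set c | gap s c <= e].
Proof.
apply: (@preimage_closed _ _ (gap s) [set x | x <= e]).
  by move=> c _; exact: gap_continuousr.
exact: closed_le.
Qed.

Lemma closed_gap_lel (c : K * K) : closed [set s | gap s c <= 0].
Proof.
apply: (@preimage_closed _ _ (gap^~ c) [set x | x <= 0]).
  by move=> s _; exact: gap_continuousl.
exact: closed_le.
Qed.

Definition osc_le (e : R) (U : set S) : Prop :=
  forall s t k, U s -> U t -> `|f (s, k) - f (t, k)| <= e.

(** The values [f (a, k)], for [a] in [pts], depend continuously on [k] as a
vector, so compactness of [K] makes the set of these vectors totally bounded. *)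
Lemma finite_net (pts : seq S) (d : R) : 0 < d ->
  exists L : seq K, forall k, exists2 j, j \in L &
    forall a, a \in pts -> gap a (k, j) < d.
Proof.
move=> d0.
pose V (j : K) := [set k | forall a, a \in pts -> gap a (k, j) < d].
have oV j : open (V j).
  rewrite openE => k Vk.
  suff : \forall k' \near k, forall a, a \in pts -> gap a (k', j) < d by [].
  elim: pts @V Vk => [|a pts IH] V Vk; first by apply: nearW.
  have Va : gap a (k, j) < d by apply: Vk; rewrite mem_head.
  have /IH Vp : forall b, b \in pts -> gap b (k, j) < d.
    by move=> b bp; apply: Vk; rewrite inE bp orbT.
  have Vk' : \forall k' \near k, gap a (k', j) < d.
    have cg : (fun k' => gap a (k', j)) @ k --> gap a (k, j).
      by apply: cvg_norm; apply: cvgB; [exact: (sepf.1 a)|exact: cvg_cst].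
    by apply: (cvgr_lt _ cg).
  near=> k' => b; rewrite inE => /predU1P[->|bp]; first by near: k'.
  by move: b bp; near: k'.
have [|L _ LP] := cptK (fun j (_ : setT j) => oV j).
  by move=> k _; exists k => // a _; rewrite /gap subrr normr0.
exists (finmap.enum_fset L) => k; have [j Lj Vj] := LP k I; exists j => //.
Unshelve. all: by end_near. Qed.

Lemma near_finite_continuity (L : seq K) (s : S) (e : R) : 0 < e ->
  \forall t \near s, forall j, j \in L -> `|f (s, j) - f (t, j)| < e.
Proof.
move=> e0; elim: L => [|j L IH]; first exact: nearW.
have /cvgrPdist_lt /(_ e e0) jP := sepf.2 j s.
near=> t => i; rewrite inE => /predU1P[->|iL]; first by near: t.
by move: i iL; near: t.
Unshelve. all: by end_near. Qed.

(** Suppose that pairs indistinguishable by [pts] up to [d] are indistinguishable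
up to [e] by every point of [A].  Replacing [k] by a member of the net for [pts]
then costs at most [e] at each point of [A], and near a point of [A] the
functions [f (_, j)], for the finitely many [j] of the net, vary by less than
[e]: this bounds the oscillation by [3 * e]. *)
Lemma separating_pair (A : set S) (pts : seq S) (e d : R) :
  0 < e -> 0 < d -> nonvoid_open A ->
  (forall U, nonvoid_open U -> U `<=` A -> ~ osc_le (3 * e) U) ->
  exists B c, [/\ nonvoid_open B, B `<=` A,
    forall a, a \in pts -> gap a c < d & forall b, B b -> e <= gap b c].
Proof.
move=> e0 d0 [oA [s As]] nf.
(* The strict inequality makes the set of suitable points [b] open. *)
have [[b [c [Ab cd ec]]]|no] := pselect (exists b c,
    [/\ A b, forall a, a \in pts -> gap a c < d & e < gap b c]).
  pose B := A `&` [set b | e < gap b c].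
  have oB : open B.
    apply: openI => //; apply: (@open_comp _ _ (gap^~ c) [set x | e < x]).
      by move=> ? _; exact: gap_continuousl.
    exact: open_gt.
  exists B, c; split=> //; [by split=> //; exists b|by move=> ? []|].
  by move=> x [_] /ltW.
have [L LP] := finite_net pts d0.
have nbL := near_finite_continuity L s (divr_gt0 e0 (ltr0Sn R 1)).
pose U := A `&` [set t | forall j, j \in L -> `|f (s, j) - f (t, j)| < e / 2]°.
exfalso; apply: (nf U).
- split; first by apply: openI => //; exact: open_interior.
  by exists s; split=> //; apply: nbhs_singleton; exact: nbhs_interior.
- by move=> ? [].
move=> t u k [At /interior_subset tL] [Au /interior_subset uL].
have [j jL jk] := LP k.
have small b : A b -> gap b (k, j) <= e.
  move=> Ab; rewrite leNgt; apply/negP => eb; apply: no.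
  by exists b, (k, j).
have := small t At; have := small u Au; rewrite /gap /=.
have := tL j jL; have := uL j jL.
rewrite !ltr_norml !ler_norml => /andP[? ?] /andP[? ?] /andP[? ?] /andP[? ?].
by apply/andP; split; lra.
Qed.

(** Beta answers a move [(A, a)] with the set given by [separating_pair], for all
the points played so far and a tolerance tending to 0. *)
Lemma winning_of_large_osc (W : set S) (e : R) : 0 < e -> nonvoid_open W ->
  (forall U, nonvoid_open U -> U `<=` W -> ~ osc_le (3 * e) U) ->
  exists2 sigma : beta_strategy S, sigma [::] = W & beta_winning sigma.
Proof.
move=> e0 oW nf.
(* [beta] reads the last set of alpha and the list of all his points; its answer
   is arbitrary on sets that do not occur in a play from [W]. *)
have /choice[beta betaP] : forall Ap : set S * seq S, exists B,
    nonvoid_open Ap.1 -> Ap.1 `<=` W ->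
    [/\ nonvoid_open B, B `<=` Ap.1 & exists c : K * K,
      (forall a, a \in Ap.2 -> gap a c < (size Ap.2).+1%:R^-1) /\
      (forall b, B b -> e <= gap b c)].
  move=> [A pts] /=.
  have [[oA AW]|no] := pselect (nonvoid_open A /\ A `<=` W); last first.
    by exists W => oA AW; case: no.
  have [||B [c [oB BA cp cB]]] :=
    @separating_pair A pts e (size pts).+1%:R^-1 e0 _ oA.
  - by rewrite invr_gt0.
  - by move=> U oU UA; apply: nf => //; exact: subset_trans AW.
  - by exists B => _ _; split=> //; exists c.
pose sigma (s : seq (set S * S)) :=
  if s is m :: s' then beta ((last m s').1, map snd s) else W.
have sigmaE s m : sigma (rcons s m) = beta (m.1, map snd (rcons s m)).
  by case: s => [|m' s] //=; rewrite last_rcons.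
have sigmaW s : alpha_moves sigma s -> sigma s `<=` W.
  elim=> [//|{}s A a ams IH oA As]; rewrite sigmaE.
  have AW := subset_trans As IH.
  have [//|_ BA _] := betaP (A, map snd (rcons s (A, a))) oA.
  exact: subset_trans AW.
have legal : legal_strategy sigma.
  split=> // s A a /alpha_moves_rconsE[ams oA As]; rewrite sigmaE.
  have AW := subset_trans As (sigmaW _ ams).
  by have [] := betaP (A, map snd (rcons s (A, a))) oA AW.
exists sigma => //; split=> // B A a [play BE] [p [cp Ap]].
have AW n : A n `<=` W.
  elim: n => [|n IH].
    by have [_ _ + _] := play 0%N; rewrite BE.
  have [_ _ _ BA] := play n; have [_ _ AB _] := play n.+1.
  exact: subset_trans AB (subset_trans BA IH).
have /choice[c cP] : forall n, exists c : K * K,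
    (forall i, (i <= n)%N -> gap (a i) c < n.+1%:R^-1) /\ e <= gap p c.
  move=> n; have [_ oA _ _] := play n.
  have [_ _ [c [c1 c2]]] :=
    betaP (A n, map snd (mkseq (fun j => (A j, a j)) n.+1)) oA (AW n).
  exists c; split=> [i le_in|].
    have /c1 /lt_trans-> // : a i \in map snd (mkseq (fun j => (A j, a j)) n.+1).
      by rewrite -map_comp; apply/mapP; exists i => //; rewrite mem_iota.
    by rewrite size_map size_mkseq ltf_pV2 ?posrE// ltr_nat.
  apply: c2; have [_ _ AB _] := play n.+1.
  by have := AB _ (Ap n.+1 I); rewrite BE mkseqS sigmaE -mkseqS.
have [q qP] : exists q, forall C : set (K * K), closed C ->
    (\forall n \near \oo, C (c n)) -> C q.
  apply: compact_sequence_closed; rewrite -setXTT.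
  by apply: compact_setX; exact: cover_compactT_compactT.
have pq : e <= gap p q.
  apply: (qP [set q | e <= gap p q]); first exact: closed_gap_ge.
  by apply: nearW => n; have [] := cP n.
have aq i : gap (a i) q <= 0.
  apply/ler_addgt0Pl => d d0; rewrite addr0.
  apply: (qP [set q | gap (a i) q <= d]); first exact: closed_gap_ler.
  have invd := near_infty_natSinv_lt (PosNum d0).
  near=> n; have [cn _] := cP n; apply: ltW; apply: lt_trans (cn i _) _.
    by near: n; exact: nbhs_infty_ge.
  by near: n.
have : gap p q <= 0.
  suff : [set s | gap s q <= 0] p by [].
  have /closure_id -> : closed [set s | gap s q <= 0] by exact: closed_gap_lel.
  by apply: closureS cp => _ [i _ <-]; exact: aq.
by move=> /(le_trans pq); rewrite leNgt e0.
Unshelve. all: by end_near. Qed.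

Definition osc_le_points (e : R) : set S :=
  \bigcup_(U in [set U | open U /\ osc_le e U]) U.

Lemma open_osc_le_points e : open (osc_le_points e).
Proof. by apply: bigcup_open => U []. Qed.

Lemma continuous_osc_le_points s k :
  (forall n, osc_le_points n.+1%:R^-1 s) -> {for (s, k), continuous f}.
Proof.
move=> fs; suff near_lt (e : R) : 0 < e ->
    \forall q \near (s, k), `|f (s, k) - f q| < e.
  by apply/cvgrPdist_lt => e; exact: near_lt.
move=> e0.
have e20 : 0 < e / 2 by rewrite divr_gt0.
have [N _ NP] := near_infty_natSinv_lt (PosNum e20).
have [U [oU fU] Us] := fs N.
have /cvgrPdist_lt /(_ _ e20) kP := sepf.1 s k.
exists (U, [set k' | `|f (s, k) - f (s, k')| < e / 2]) => /=.
  by split=> //; exact: open_nbhs_nbhs.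
move=> [t k'] /= [Ut ek].
have := fU s t k' Us Ut; have /= : N.+1%:R^-1 < e / 2 := NP N (leqnn N).
move: ek (N.+1%:R^-1) => + r.
rewrite !ltr_norml !ler_norml => /andP[? ?] ? /andP[? ?].
by apply/andP; split; lra.
Qed.

Hypothesis winning_meager : forall sigma : beta_strategy S,
  beta_winning sigma -> meager (sigma [::]).

(** The complement [C] is closed, so it is the union of its interior and a nowhere
dense set; if the interior is nonvoid, it is the opening move of a winning
strategy. *)
Lemma meager_not_osc_le_points e : 0 < e -> meager (~` osc_le_points e).
Proof.
move=> e0; set C := ~` osc_le_points e.
have cC : closed C by apply: open_closedC; exact: open_osc_le_points.
apply: (@meagerS _ _ (C° `|` (C `\` C°))).
  by move=> x Cx; have [|] := pselect (C° x); [left|right].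
apply: meagerU; last first.
  apply: meager_nowhere_dense; rewrite -subset0 => x Ux.
  have DC : closure (C `\` C°) `<=` C `\` C°.
    have /closure_id <- // : closed (C `\` C°).
    by apply: closedI => //; apply: open_closedC; exact: open_interior.
  have [_ []] := DC _ (interior_subset Ux).
  apply: interiorS Ux; exact: subset_trans DC (@subDsetl _ _ _).
have [/set0P C0|/negP] := boolP (C° != set0); last first.
  move=> /negP; rewrite negbK => /eqP ->; apply: meager_nowhere_dense.
  by rewrite closure0 interior0.
have e30 : 0 < e / 3 by rewrite divr_gt0.
have [||sigma <-] := @winning_of_large_osc C° _ e30; last exact: winning_meager.
  by split=> //; exact: open_interior.
move=> U [oU [x Ux]] UC fU; apply: (interior_subset (UC _ Ux)).
by exists U => //; split=> //; move: fU; rewrite mulrC divfK.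
Qed.

Lemma meager_discontinuity :
  meager [set s | ~ forall k, {for (s, k), continuous f}].
Proof.
apply: (@meagerS _ _ (\bigcup_n ~` osc_le_points n.+1%:R^-1)).
  move=> s /= ns; apply: contrapT => nb; apply: ns => k.
  apply: continuous_osc_le_points => n; apply: contrapT => nf.
  by apply: nb; exists n.
by apply: meager_bigcup => n; exact: meager_not_osc_le_points.
Qed.

End JointContinuity.

(** * The theorem *)

Theorem theorem3p11 (R : realType) (X : topologicalType)
    (Y : pseudoMetricType R) (hX : separable_space X) :
  (Baire_space (X * Y)%type ->
     beta_defavorable_Jp (X * Y)%type /\ N_space R (X * Y)%type) /\
  (nonmeager_space (X * Y)%type -> gN_space R (X * Y)%type).
Proof.
have winning_meager := @winning_opening_meager_prod R X Y hX.
split=> [baire|nonmeager]; last first.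
  move=> K cptK f sepf; apply: contrapT => no; apply: nonmeager.
  apply: meagerS (meager_discontinuity cptK sepf winning_meager).
  by move=> s _ cs; apply: no; exists s.
split.
  move=> [sigma win]; apply: (baire (sigma [::])); last exact: winning_meager.
  by have [[]] := win.
move=> K cptK f sepf.
exists [set s | forall k, {for (s, k), continuous f}]; split; last first.
  by move=> s k; apply.
move=> O O0 oO; apply: contrapT => no; apply: (baire O) => //.
apply: meagerS (meager_discontinuity cptK sepf winning_meager).
by move=> s Os cs; apply: no; exists s.
Qed.
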